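(* Let $R$ be an order in a number field $K$ and let $A$ be an $R$-algebra which is free of finite rank as an $R$-module, and let $r=r(A,R)$. If $r_0<r_{\mathfrak p}$ for some maximal ideal $\mathfrak p$ of $R$, then $r=\max\{r_{\mathfrak p}:\mathfrak p\in\operatorname{mSpec}R\}$. If $r_0=r_{\mathfrak p}$ for all maximal ideals $\mathfrak p$, then $r_0\le r\le r_0+1$.
   Context: Algebras are associative and unital. $r(B,S)$ denotes the smallest number of generators of an $S$-algebra $B$ (generation meaning the non-commutative monomials, including $1$, span $B$ as an $S$-module). For a prime ideal $\mathfrak p$ of $R$, $\kappa(\mathfrak p)$ is the fraction field of $R/\mathfrak p$ and $r_{\mathfrak p}=r(A\otimes_R\kappa(\mathfrak p),\kappa(\mathfrak p))$; $r_0=r(A\otimes_RK,K)$. An order in $K$ is a subring of $K$ free of rank $[K:\mathbb Q]$ as a $\mathbb Z$-module. *)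

(* Defs.v *)
From HB Require Import structures.
From mathcomp Require Import all_boot all_order all_algebra all_field.
Set Implicit Arguments. Unset Strict Implicit. Unset Printing Implicit Defensive.
Import Order.TTheory GRing.Theory Num.Theory.
Local Open Scope ring_scope.

Section Defs.
Variable K : fieldType.

Definition is_order (L : fieldExtType rat) (R : {pred L}) : Prop :=
  [/\ 1 \in R,
      (forall x y, x \in R -> y \in R -> x - y \in R),
      (forall x y, x \in R -> y \in R -> x * y \in R) &
      exists b : 'I_(\dim {:L}) -> L,
        (forall z : 'I_(\dim {:L}) -> int,
            \sum_i (z i)%:~R * b i = 0 -> forall i, z i = 0) /\
        (forall x, x \in R <-> exists z : 'I_(\dim {:L}) -> int,
                                  x = \sum_i (z i)%:~R * b i)].

Definition is_ideal (R I : {pred K}) : Prop :=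
  [/\ (forall x, x \in I -> x \in R), 0 \in I,
      (forall x y, x \in I -> y \in I -> x + y \in I) &
      (forall a x, a \in R -> x \in I -> a * x \in I)].

Definition is_maximal_ideal (R p : {pred K}) : Prop :=
  [/\ is_ideal R p, 1 \notin p &
      forall q : {pred K}, is_ideal R q -> {subset p <= q} ->
        1 \notin q -> q =i p].

(* A free algebra of rank n over a subring, given by a basis e_1..e_n, its
   structure constants c i j k (e_i e_j = sum_k c i j k e_k) and the
   coordinate vector u of its unit.  Elements are coordinate rows. *)
Variable n : nat.
Implicit Types (c : 'I_n -> 'I_n -> 'I_n -> K) (u v w : 'rV[K]_n).

Definition mulA c v w : 'rV[K]_n :=
  \row_k \sum_i \sum_j v 0 i * w 0 j * c i j k.

Definition inS (S : {pred K}) v := forall k, v 0 k \in S.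

Definition monomial c (one : 'rV[K]_n) m (g : 'I_m -> 'rV[K]_n)
  (wd : seq 'I_m) : 'rV[K]_n :=
  foldr (fun i acc => mulA c (g i) acc) one wd.

Definition is_free_algebra (R : {pred K}) c (one : 'rV[K]_n) : Prop :=
  [/\ (forall i j k, c i j k \in R), inS R one,
      (forall u v w, inS R u -> inS R v -> inS R w ->
          mulA c (mulA c u v) w = mulA c u (mulA c v w)) &
      (forall v, inS R v -> mulA c one v = v /\ mulA c v one = v)].

(* The algebra S^n (structure constants c, unit one) taken modulo the ideal
   I of S (i.e. (S/I) (x)_S S^n when I is maximal) is generated by m
   elements over S/I: there are g_1..g_m in S^n such that every element of
   S^n is congruent mod I S^n to an S-linear combination of monomials in the
   g_i.  With I = 0 this is plain generation over S. *)
Definition generated_by (S I : {pred K}) c (one : 'rV[K]_n) (m : nat) : Prop :=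
  exists g : 'I_m -> 'rV[K]_n, (forall i, inS S (g i)) /\
    forall v, inS S v ->
      exists (N : nat) (wd : 'I_N -> seq 'I_m) (a : 'I_N -> K),
        (forall t, a t \in S) /\
        forall k, (v - \sum_t a t *: monomial c one g (wd t)) 0 k \in I.

End Defs.

Definition least_nat (P : nat -> Prop) (m : nat) : Prop :=
  P m /\ forall k, P k -> (m <= k)%N.

Definition zero_pred {K : fieldType} : {pred K} := [pred x : K | x == 0].
Definition all_pred {K : fieldType} : {pred K} := [pred x : K | true].

(* Main.v *)
Require Import Defs.
From HB Require Import structures.
From mathcomp Require Import all_boot all_order all_algebra all_field.
From mathcomp Require Import perm boolp classical_sets.
Import Order.TTheory GRing.Theory Num.Theory.
Local Open Scope ring_scope.

(** A tuple generates A over R as soon as it generates A/pA for every maximal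
    ideal p, so it suffices, for k > r0 with k >= r_p for all p, to build one
    k-tuple that works at all p at once.  Its entries are chosen one by one,
    subject to two conditions: the chosen entries x extend to a generating
    k-tuple modulo each p, and together with some z they generate A over K, where
    x and z have at most k - 1 entries in total as long as z is nonempty.  The
    elements x, z generate A/pA for all p outside a finite set.  At the
    exceptional p the next entry t is prescribed by the Chinese remainder theorem;
    at the others nothing is needed, because x, t, z has at most k entries.
    Replacing t by t + N z_0, with N in every exceptional p and generic, allows t
    to take the place of the first entry z_0 of z. *)

(** * Maximal ideals, Zorn's lemma and the Chinese remainder theorem *)

Section Ideals.
Set Implicit Arguments.
Unset Strict Implicit.
Variables (K : fieldType) (R : subringClosed K).
Implicit Types I p q : {pred K}.

Lemma ideal_sub I x y : is_ideal R I -> x \in I -> y \in I -> x - y \in I.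
Proof.
by case=> _ _ ID IM Ix Iy; apply: ID => //; rewrite -mulN1r IM ?rpredN1.
Qed.

Lemma zero_ideal : is_ideal R zero_pred.
Proof.
split=> [x /eqP->||x y|a x]; rewrite ?rpred0 ?inE //.
  by move=> /eqP-> /eqP->; rewrite addr0.
by move=> _ /eqP->; rewrite mulr0.
Qed.

Lemma ideal_sum I (J : Type) (s : seq J) (P : pred J) (F : J -> K) :
  is_ideal R I -> (forall i, P i -> F i \in I) ->
  \sum_(i <- s | P i) F i \in I.
Proof. by case=> _ I0 ID _ IF; elim/big_ind: _. Qed.

(** The ideal [p + R a] strictly contains [p], so it contains 1. *)
Lemma maximal_inverse p a : is_maximal_ideal R p -> a \in R -> a \notin p ->
  exists2 u, u \in R & 1 - u * a \in p.
Proof.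
case=> idp p1 pmax Ra Npa; have [pR p0 pD pM] := idp.
pose q : {pred K} := [pred x | `[< exists2 u, u \in R & x - u * a \in p >]].
have idq : is_ideal R q.
  split.
  - move=> x /asboolP[u Ru] /pR; rewrite -[X in _ -> X \in _](subrK (u * a)).
    by move=> Rx; rewrite rpredD // rpredM.
  - by apply/asboolP; exists 0; rewrite ?rpred0 // mul0r subrr.
  - move=> x y /asboolP[u Ru pu] /asboolP[v Rv pv]; apply/asboolP.
    by exists (u + v); [rewrite rpredD | rewrite mulrDl opprD addrACA pD].
  - move=> b x Rb /asboolP[u Ru pu]; apply/asboolP.
    by exists (b * u); [rewrite rpredM | rewrite -mulrA -mulrBr pM].
have pq : {subset p <= q}.
  by move=> x px; apply/asboolP; exists 0; rewrite ?rpred0 // mul0r subr0.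
have qa : a \in q by apply/asboolP; exists 1; rewrite ?rpred1 // mul1r subrr.
have [/asboolP//|Nq1] := boolP (1 \in q).
by rewrite (pmax q idq pq Nq1) (negPf Npa) in qa.
Qed.

(** An element of [q] outside [p], multiplied by its inverse modulo [p], serves as [b]. If there is
    no such element, [q] lies in [p] and maximality of [q] forces equality. *)
Lemma maximal_comaximal p q : is_maximal_ideal R p -> is_maximal_ideal R q ->
  p <> q -> exists2 b, b \in q & 1 - b \in p.
Proof.
move=> maxp maxq; have [[qR q0 qD qM] q1 qmax] := maxq.
have [idp p1 pmax] := maxp.
have [[b /andP[qb pb]] _|qp []] := 
  pselect (exists b, (b \in q) && (b \notin p)).
  have [u Ru pu] := maximal_inverse maxp (qR b qb) pb.
  by exists (u * b); rewrite ?qM.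
apply: functional_extensionality_dep => x; apply: (qmax p idp) p1 x => x qx.
by apply/negPn/negP=> px; case: qp; exists x; rewrite qx.
Qed.

Lemma exists_maximal_ideal I : is_ideal R I -> 1 \notin I ->
  exists p, is_maximal_ideal R p /\ {subset I <= p}.
Proof.
move=> idI I1.
pose T := {q : K -> bool |
  [/\ is_ideal R q, 1 \notin q & {subset I <= q}]}.
pose le (q r : T) := `[< {subset sval q <= sval r} >].
have valT (q : T) : [/\ is_ideal R (sval q), 1 \notin sval q &
  {subset I <= sval q}] by case: q.
have ext (q r : {pred K}) : {subset q <= r} -> {subset r <= q} -> q = r.
  move=> qr rq; apply: functional_extensionality_dep => x.
  by apply/idP/idP; [apply: qr|apply: rq].
have [||||[p [idp p1 Ip]] pmax] := @Zorn T le.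
- by move=> t; apply/asboolP.
- by move=> r s t /asboolP rs /asboolP st; apply/asboolP => x /rs/st.
- move=> [r hr] [s hs] /asboolP/= rs /asboolP/= sr.
  by apply: eq_exist => /=; apply: ext.
(* The empty chain is bounded by [I] itself; a nonempty one by its union, which stays proper because
   1 lies in no member. *)
- move=> C totC; have [[q0 Cq0]|C0] := pselect (exists t : T, C t); last first.
    exists (exist _ I (And3 idI I1 (fun x => id))) => s Cs.
    by case: C0; exists s.
  pose U : {pred K} := [pred x | `[< exists2 q : T, C q & x \in sval q >]].
  have hU : [/\ is_ideal R U, 1 \notin U & {subset I <= U}].
    have UD (q r : T) x y : C r -> le q r ->
        x \in sval q -> y \in sval r -> x + y \in U.
      move=> Cr /asboolP qr /qr rx ry; apply/asboolP; exists r => //.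
      by have [[_ _ rD _] _ _] := valT r; apply: rD.
    split.
    + split.
      * by move=> x /asboolP[q _]; have [[qR _ _ _] _ _] := valT q; apply: qR.
      * by apply/asboolP; exists q0 => //; have [[]] := valT q0.
      * move=> x y /asboolP[q Cq qx] /asboolP[r Cr ry].
        have [qr|rq] := totC _ _ Cq Cr; first exact: UD Cr qr qx ry.
        by rewrite addrC; apply: UD Cq rq ry qx.
      * move=> a x Ra /asboolP[q Cq qx]; apply/asboolP; exists q => //.
        by have [[_ _ _ qM] _ _] := valT q; apply: qM.
    + by apply/asboolP => -[q _]; have [_ /negP] := valT q.
    + move=> x Ix; apply/asboolP; exists q0 => //.
      by have [_ _] := valT q0; apply.
  exists (exist _ U hU) => q Cq; apply/asboolP => /= x qx.
  by apply/asboolP; exists q.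
exists p; split=> //; split=> // q idq pq q1 x.
have hq : [/\ is_ideal R q, 1 \notin q & {subset I <= q}].
  by split=> // y /Ip/pq.
by have /(congr1 sval)/= -> := pmax (exist _ q hq) (asboolT pq).
Qed.

(* The injection [code] into a finite type says that only finitely many ideals
   satisfy [G]. *)
Lemma maximal_crt (n : nat) (T : finType) (G : {pred K} -> Prop)
    (code : {pred K} -> T) (target : {pred K} -> 'rV[K]_n) :
  (forall p, G p -> is_maximal_ideal R p) ->
  (forall p q, G p -> G q -> code p = code q -> p = q) ->
  (forall p, inS R (target p)) ->
  exists2 t : 'rV[K]_n, inS R t & forall p, G p -> inS p (t - target p).
Proof.
move=> maxG codeI Rtarget.
(* [rep] inverts [code]. Values of [T] that are not codes get the zero ideal as a dummy, and [good]
   filters them out. *)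
have /choice[rep repP] (i : T) : exists q,
    (exists2 p, G p & code p = i) -> G q /\ code q = i.
  have [[p Gp pi]|] := pselect (exists2 p, G p & code p = i); first by exists p.
  by exists (zero_pred : {pred K}).
have repK p : G p -> rep (code p) = p.
  by move=> Gp; have [|Gr] := repP (code p); [exists p | apply: codeI].
pose good i := `[< G (rep i) /\ code (rep i) = i >].
(* [e] is a product over [j] of elements congruent to 1 modulo [rep i] and lying in [rep j]; the
   factor is 1 if [j] is [i] or is not good. *)
have idemp i : exists e, [/\ e \in R, good i -> 1 - e \in rep i &
    forall j, good j -> good i -> j != i -> e \in rep j].
  have [/asboolP[Gi codei]|Ni] := boolP (good i); last first.
    by exists 1; rewrite rpred1.
  have [[iR i0 iD iM] i1 imax] := maxG _ Gi.
  have /choice[b bP] j : exists b, [/\ b \in R, 1 - b \in rep i &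
      good j -> j != i -> b \in rep j].
    have [[/asboolP[Gj codej] ji]|nj] := pselect (good j /\ j != i); last first.
      by exists 1; rewrite rpred1 subrr; split=> // gj ji; case: nj.
    have [|b jb ib] := maximal_comaximal (maxG _ Gi) (maxG _ Gj).
      by move=> ij; rewrite -codej -codei ij eqxx in ji.
    by exists b; split=> //; have [[jR _ _ _] _ _] := maxG _ Gj; apply: jR.
  exists (\prod_j b j); split=> [||j gj _ ji].
  - by rewrite rpred_prod // => j _; have [] := bP j.
  - move=> _; suff [] : \prod_j b j \in R /\ 1 - \prod_j b j \in rep i by [].
    elim/big_ind: _ => [|x y [Rx ix] [Ry iy]|j _].
    + by rewrite rpred1 subrr.
    + rewrite rpredM //; split=> //.
      by rewrite -[1](subrK x) -addrA -{2}[x]mulr1 -mulrBr iD // iM.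
    + by have [] := bP j.
  - have [[jR j0 jD jM] _ _] : is_maximal_ideal R (rep j).
      by apply: maxG; have /asboolP[] := gj.
    rewrite (bigD1 j) //= mulrC jM //; last by have [_ _] := bP j; apply.
    by rewrite rpred_prod // => k _; have [] := bP k.
have [e eP] := choice idemp.
exists (\sum_(i | good i) e i *: target (rep i)).
  move=> k; rewrite summxE rpred_sum // => i _; rewrite mxE rpredM //.
    by have [] := eP i.
  exact: Rtarget.
move=> p Gp k; rewrite -(repK p Gp); set i := code p.
have gi : good i by apply/asboolP; rewrite repK.
have idi : is_ideal R (rep i).
  by have [] : is_maximal_ideal R (rep i) by apply/maxG; rewrite repK.
have [iR i0 iD iM] := idi.
rewrite !mxE summxE (bigD1 i) //= mxE addrAC.
rewrite iD //; last first.
  apply: ideal_sum => // j /andP[gj ji]; rewrite mxE mulrC iM //.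
    exact: Rtarget.
  by have [_ _] := eP j; apply; rewrite // eq_sym.
rewrite -[X in _ - X]mul1r -mulrBl mulrC iM //; first exact: Rtarget.
have [_ /(_ gi) ei _] := eP i.
by rewrite -opprB -mulN1r iM ?rpredN1.
Qed.
End Ideals.

(** * Generation by lists of vectors, and its behaviour under scaling *)

Section Generation.
Set Implicit Arguments.
Unset Strict Implicit.
Variables (K : fieldType) (n : nat).
Variables (c : 'I_n -> 'I_n -> 'I_n -> K) (one : 'rV[K]_n).
Implicit Types (S I : {pred K}) (G : seq 'rV[K]_n).

Local Notation mulA := Defs.mulA.

Definition mono (l : seq 'rV[K]_n) := foldr (mulA c) one l.

(** The [S]-span of the monomials in the entries of [G]. Words are lists of vectors rather than of
    indices, so that inclusions of lists of generators act directly and span membership can be used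
    by induction. *)
Inductive lincomb S G : 'rV[K]_n -> Prop :=
| lincomb0 : lincomb S G 0
| lincombD a l v : a \in S -> {subset l <= G} -> lincomb S G v ->
    lincomb S G (a *: mono l + v).

Definition generates S I G :=
  forall v, inS S v -> exists2 w, lincomb S G w & inS I (v - w).

Lemma mulAZ a b v w : mulA c (a *: v) (b *: w) = (a * b) *: mulA c v w.
Proof.
apply/rowP => k; rewrite !mxE mulr_sumr; apply: eq_bigr => i _.
rewrite mulr_sumr; apply: eq_bigr => j _; rewrite !mxE.
by rewrite !mulrA [a * v _ _ * b]mulrAC.
Qed.

Lemma mulAB v w v' w' :
  mulA c v w - mulA c v' w' = mulA c (v - v') w + mulA c v' (w - w').
Proof.
apply/rowP => k; rewrite !mxE -sumrB -big_split; apply: eq_bigr => i _.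
rewrite -sumrB -big_split; apply: eq_bigr => j _; rewrite !mxE.
by rewrite /= mulrBr !mulrBl addrA subrK.
Qed.

Lemma lincomb_add S G v w :
  lincomb S G v -> lincomb S G w -> lincomb S G (v + w).
Proof.
move=> Gv Gw; elim: Gv => [|a l u Sa Gl _ IH]; first by rewrite add0r.
by rewrite -addrA; apply: lincombD.
Qed.

Lemma lincomb_mono S G a l :
  a \in S -> {subset l <= G} -> lincomb S G (a *: mono l).
Proof.
move=> Sa Gl; rewrite -[_ *: _]addr0.
by apply: lincombD => //; apply: lincomb0.
Qed.

Lemma lincomb_sum S G (J : Type) (s : seq J) (P : pred J) F :
  (forall i, P i -> lincomb S G (F i)) -> lincomb S G (\sum_(i <- s | P i) F i).
Proof.
by move=> GF; elim/big_ind: _ => //; [apply: lincomb0|apply: lincomb_add].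
Qed.

Lemma lincombZ S G a v :
  {in S, forall b, a * b \in S} -> lincomb S G v -> lincomb S G (a *: v).
Proof.
move=> Sa; elim=> [|b l u Sb Gl _ IH].
  by rewrite scaler0; apply: lincomb0.
by rewrite scalerDr scalerA; apply: lincombD; rewrite ?Sa.
Qed.

Lemma lincomb_subset S S' G G' v : {subset S <= S'} -> {subset G <= G'} ->
  lincomb S G v -> lincomb S' G' v.
Proof.
move=> SS' GG'; elim=> [|a l u Sa Gl _ IH]; first exact: lincomb0.
by apply: lincombD => //; [apply: SS' | move=> x /Gl/GG'].
Qed.

Lemma generates_subset S I G G' :
  {subset G <= G'} -> generates S I G -> generates S I G'.
Proof.
move=> GG' gG v /gG[w Gw Iw]; exists w => //; exact: lincomb_subset Gw.
Qed.

Lemma generates_ideal_subset S I J G :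
  {subset I <= J} -> generates S I G -> generates S J G.
Proof. by move=> IJ gG v /gG[w Gw Iw]; exists w => // k; apply: IJ. Qed.

Lemma generates_basis (S : subringClosed K) I G : is_ideal S I ->
  (forall i, exists2 w, lincomb S G w & inS I (delta_mx 0 i - w)) ->
  generates S I G.
Proof.
move=> idI basis v Sv; have [IS I0 ID IM] := idI.
have /choice[w wP] i : exists w, lincomb S G w /\ inS I (delta_mx 0 i - w).
  by have [w] := basis i; exists w.
exists (\sum_i v 0 i *: w i).
  apply: lincomb_sum => i _; apply: lincombZ; last by have [] := wP i.
  by move=> b Sb; rewrite rpredM.
move=> k; rewrite [v in v - _]row_sum_delta -sumrB summxE.
apply: (ideal_sum _ idI) => i _.
by rewrite -scalerBr mxE IM //; have [_] := wP i; apply.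
Qed.

Lemma lincomb_seq S m (g : 'I_m -> 'rV[K]_n) w : lincomb S (codom g) w ->
  exists2 s : seq (K * seq 'I_m), (forall x, x \in s -> x.1 \in S) &
    w = \sum_(x <- s) x.1 *: monomial c one g x.2.
Proof.
elim=> [|a l v Sa Gl _ [s sS ->]]; first by exists [::]; rewrite ?big_nil.
have [l' ->] : exists l', l = map g l'.
  elim: l Gl => [|x l IH] Gl; first by exists [::].
  have [|l' ->] := IH; first by move=> y yl; rewrite Gl // inE yl orbT.
  by have /codomP[i ->] := Gl x (mem_head _ _); exists (i :: l').
exists ((a, l') :: s).
  by move=> x; rewrite inE => /orP[/eqP->|/sS].
rewrite big_cons /=; congr (_ *: _ + _).
by elim: l' {Gl} => //= i l' ->.
Qed.

(** Bridge between indexed families of generators and lists, on which the rest of the proof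
    works. *)
Lemma generated_byP S I m : generated_by S I c one m <->
  exists G, [/\ size G = m, forall x, x \in G -> inS S x & generates S I G].
Proof.
split=> [[g [gS gg]]|[G [<- GS gG]]].
  exists (codom g); split=> [|x /codomP[i ->]//|v Sv].
    by rewrite size_codom card_ord.
  have [N [wd [a [aS aI]]]] := gg v Sv.
  exists (\sum_t a t *: monomial c one g (wd t)) => //.
  apply: lincomb_sum => t _.
  have -> : monomial c one g (wd t) = mono (map g (wd t)).
    by elim: (wd t) => //= i l ->.
  apply: lincomb_mono => // x /mapP[i _ ->]; exact: codom_f.
pose g (i : 'I_(size G)) := nth 0 G i.
have Gg : {subset G <= codom g}.
  by move=> x /(nthP 0)[i lt_i <-]; apply/codomP; exists (Ordinal lt_i).
exists g; split=> [i|v Sv]; first by apply: GS; rewrite mem_nth.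
have [w /(lincomb_subset (fun _ => id) Gg)/lincomb_seq[s sS ->] Iw] := gG v Sv.
exists (size s), (fun t => (tnth (in_tuple s) t).2),
  (fun t => (tnth (in_tuple s) t).1).
split=> [t|k]; first by apply: sS; apply: mem_tnth.
by have := Iw k; rewrite big_tnth.
Qed.

(** Padding with zero vectors brings the list to length exactly [m]. *)
Lemma generates_generated_by (S : subringClosed K) I m G :
  (size G <= m)%N -> (forall x, x \in G -> inS S x) -> generates S I G ->
  generated_by S I c one m.
Proof.
move=> Gm GS gG; apply/generated_byP; exists (G ++ nseq (m - size G) 0); split.
- by rewrite size_cat size_nseq subnKC.
- move=> x; rewrite mem_cat mem_nseq => /orP[/GS//|/andP[_ /eqP->] k].
  by rewrite mxE rpred0.
- by apply: generates_subset gG => x; rewrite mem_cat => ->.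
Qed.

Lemma generated_by_leq (S : subringClosed K) I m m' : (m <= m')%N ->
  generated_by S I c one m -> generated_by S I c one m'.
Proof.
move=> mm' /generated_byP[G [Gm GS gG]].
by apply: generates_generated_by gG => //; rewrite Gm.
Qed.

Lemma generates_field (S : subringClosed K) G :
  generates S zero_pred G -> generates all_pred zero_pred G.
Proof.
move=> gG.
suff gd i : lincomb S G (delta_mx 0 i).
  move=> v _; exists v; last by move=> k; rewrite subrr mxE inE.
  rewrite [v]row_sum_delta; apply: lincomb_sum => i _.
  exact/lincombZ/(lincomb_subset _ _ (gd i)).
have [k|w Gw w0] := gG (delta_mx 0 i); first by rewrite mxE rpred_nat.
suff -> : delta_mx 0 i = w by [].
by apply/rowP => k; have := w0 k; rewrite !mxE => /eqP/subr0_eq.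
Qed.

(** Scalars factor out of monomials, so over [K] generators matter only up to scaling. *)
Lemma lincomb_rescale G G' (f : 'rV[K]_n -> 'rV[K]_n) (a : 'rV[K]_n -> K) v :
  (forall y, y \in G -> f y \in G' /\ y = a y *: f y) ->
  lincomb all_pred G v -> lincomb all_pred G' v.
Proof.
move=> fG; elim=> [|b l u _ Gl _ IH]; first exact: lincomb0.
have [d ->] : exists d, mono l = d *: mono (map f l).
  elim: l Gl => [|x l IHl] Gl /=; first by exists 1; rewrite scale1r.
  have [|d ->] := IHl; first by move=> y yl; rewrite Gl // inE yl orbT.
  have [_ {1}->] := fG x (Gl x (mem_head _ _)).
  by exists (a x * d); rewrite mulAZ.
rewrite scalerA; apply: lincombD => // y /mapP[x lx ->].
by have [] := fG x (Gl x lx).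
Qed.

(** * Deforming one generator over [K] *)

Section Deformation.
Variables (x z' : seq 'rV[K]_n) (z t : 'rV[K]_n).

(** Since [s *: (t + s^-1 *: z) = z + s *: t], replacing [z] by [z + s *: t] in a monomial gives a
    vector polynomial in [s]. At [s = 0] it is the old monomial; for [s != 0] it is a multiple of a
    monomial in the new generators. *)
Lemma mono_deform l : {subset l <= x ++ z :: z'} ->
  exists P : 'I_n -> {poly K}, (forall k, (P k).[0] = mono l 0 k) /\
    forall s, s != 0 -> lincomb all_pred (x ++ (t + s^-1 *: z) :: z')
      (\row_k (P k).[s]).
Proof.
(* Entries of [x] and [z'] that happen to equal [z] are deformed as well; this is harmless, as they
   also become multiples of [t + s^-1 *: z]. *)
move=> Gl; pose f s y := if y == z then z + s *: t else y.
suff [P PE] : exists P : 'I_n -> {poly K},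
    forall s k, (P k).[s] = mono (map (f s) l) 0 k.
  exists P; split=> [k|s s0].
    rewrite PE; congr (mono _ 0 k); rewrite -[RHS]map_id; apply: eq_map => y.
    by rewrite /f; case: eqP => // ->; rewrite scale0r addr0.
  have -> : \row_k (P k).[s] = 1 *: mono (map (f s) l).
    by apply/rowP => k; rewrite scale1r mxE PE.
  pose u := t + s^-1 *: z.
  apply: (@lincomb_rescale (map (f s) (x ++ z :: z')) _
     (fun y => if y == z + s *: t then u else y)
     (fun y => if y == z + s *: t then s else 1)); last first.
    by apply: lincomb_mono => // y /mapP[y' /Gl Gy ->]; apply: map_f.
  move=> _ /mapP[y Gy ->]; case: eqP => [->|]; rewrite /u.
    rewrite mem_cat inE eqxx orbT scalerDr scalerA divff //.
    by rewrite scale1r addrC.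
  rewrite /f scale1r; case: eqP => // /eqP yz _; split=> //.
  move: Gy; rewrite !mem_cat !inE (negPf yz) /=.
  by move=> /orP[->|->]; rewrite ?orbT.
elim: l {Gl} => [|y l [Q QE]].
  by exists (fun k => (one 0 k)%:P) => s k; rewrite hornerC.
pose P i : {poly K} := (y 0 i)%:P + (if y == z then (t 0 i)%:P * 'X else 0).
exists (fun k => \sum_i \sum_j P i * Q j * (c i j k)%:P) => s k.
rewrite mxE horner_sum; apply: eq_bigr => i _; rewrite horner_sum.
apply: eq_bigr => j _; rewrite !hornerM hornerC QE; congr (_ * _ * _).
rewrite /P /f hornerD hornerC; case: eqP => [->|]; last by rewrite horner0 addr0.
by rewrite hornerM hornerC hornerX !mxE mulrC.
Qed.

Lemma lincomb_deform w : lincomb all_pred (x ++ z :: z') w ->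
  exists P : 'I_n -> {poly K}, (forall k, (P k).[0] = w 0 k) /\
    forall s, s != 0 -> lincomb all_pred (x ++ (t + s^-1 *: z) :: z')
      (\row_k (P k).[s]).
Proof.
elim=> [|a l v _ Gl _ [Q [Q0 Qs]]].
  exists (fun=> 0); split=> [k|s _]; first by rewrite horner0 mxE.
  have -> : \row_(k < n) (0 : {poly K}).[s] = 0.
    by apply/rowP => k; rewrite !mxE horner0.
  exact: lincomb0.
have [P [P0 Ps]] := mono_deform Gl.
exists (fun k => a *: P k + Q k); split=> [k|s s0].
  by rewrite hornerD hornerZ P0 Q0 !mxE.
have -> : \row_k (a *: P k + Q k).[s] =
    a *: (\row_k (P k).[s]) + \row_k (Q k).[s].
  by apply/rowP => k; rewrite !mxE hornerD hornerZ.
by apply: lincomb_add (Qs s s0); apply/lincombZ/Ps.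
Qed.

(** Deforming expressions of the standard basis vectors gives a matrix of polynomials that is the
    identity at [s = 0]. Its determinant is the required [p]: where it does not vanish, the deformed
    vectors still form a basis. *)
Lemma generates_deform : generates all_pred zero_pred (x ++ z :: z') ->
  exists2 p : {poly K}, p != 0 & forall s, s != 0 -> p.[s] != 0 ->
    generates all_pred zero_pred (x ++ (t + s^-1 *: z) :: z').
Proof.
move=> gG.
have /choice[P PP] (i : 'I_n) : exists P : 'I_n -> {poly K},
    (forall k, (P k).[0] = (i == k)%:R) /\
    forall s, s != 0 -> lincomb all_pred (x ++ (t + s^-1 *: z) :: z')
      (\row_k (P k).[s]).
  have [//|w Gw w0] := gG (delta_mx 0 i).
  have [P [P0 Ps]] := lincomb_deform Gw; exists P; split=> // k.
  rewrite P0; have := w0 k; rewrite !mxE eqxx /= eq_sym => /eqP/subr0_eq ->.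
  by [].
pose M : 'M[{poly K}]_n := \matrix_(i, k) P i k.
have detM s : (\det M).[s] = \det (\matrix_(i, k) (P i k).[s]).
  rewrite -/(horner_eval s (\det M)) -det_map_mx; congr (\det _).
  by apply/matrixP => i k; rewrite !mxE.
exists (\det M).
  apply/negP => /eqP M0; have := detM 0.
  have -> : \matrix_(i, k) (P i k).[0] = 1%:M.
    by apply/matrixP => i k; rewrite !mxE; have [-> _] := PP i.
  by rewrite det1 M0 horner0 => /esym/eqP; rewrite oner_eq0.
move=> s s0; rewrite detM; set N := \matrix_(i, k) _ => N0 v _.
exists v; last by move=> k; rewrite subrr mxE inE.
have -> : v = \sum_i (v *m invmx N) 0 i *: row i N.
  by rewrite -mulmx_sum_row mulmxKV // unitmxE unitfE.
apply: lincomb_sum => i _.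
have -> : row i N = \row_k (P i k).[s] by apply/rowP => k; rewrite !mxE.
by have [_ /(_ s s0) Gs] := PP i; apply: lincombZ Gs.
Qed.

End Deformation.
End Generation.

(** * Congruent generators, and generation as a local property *)

Section Congruence.
Set Implicit Arguments.
Unset Strict Implicit.
Variables (K : fieldType) (R : subringClosed K) (n : nat).
Variables (c : 'I_n -> 'I_n -> 'I_n -> K) (one : 'rV[K]_n).
Hypotheses (Rc : forall i j k, c i j k \in R) (Rone : inS R one).
Implicit Types (p I : {pred K}) (G : seq 'rV[K]_n).

Local Notation mulA := Defs.mulA.
Local Notation mono := (mono c one).
Local Notation lincomb := (lincomb c one).
Local Notation generates := (generates c one).

Lemma mono_congr I (f g : 'rV[K]_n -> 'rV[K]_n) (l : seq 'rV[K]_n) :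
  is_ideal R I ->
  (forall y, y \in l -> [/\ inS R (f y), inS R (g y) & inS I (f y - g y)]) ->
  [/\ inS R (mono (map f l)), inS R (mono (map g l)) &
      inS I (mono (map f l) - mono (map g l))].
Proof.
move=> idI; have [IR I0 ID IM] := idI.
have mulR v w : inS R v -> inS R w -> inS R (mulA c v w).
  move=> Rv Rw k; rewrite mxE.
  by do 2![apply: rpred_sum => ? _]; rewrite !rpredM.
elim: l => [|y l IH] fg /=; first by split=> // k; rewrite subrr mxE.
have [z zl|Rf Rg Ifg] := IH; first by apply: fg; rewrite inE zl orbT.
have [Rfy Rgy Iy] := fg y (mem_head _ _).
split; [exact: mulR | exact: mulR | move=> k].
rewrite mulAB mxE ID // mxE; do 2![apply: (ideal_sum _ idI) => ? _].
  by rewrite mulrC IM // mulrC IM.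
by rewrite mulrC IM // IM.
Qed.

(** Congruent integral generators have congruent monomials. This allows an entry prescribed modulo a
    maximal ideal to be replaced by a global lift. *)
Lemma generates_congr I G G' (f : 'rV[K]_n -> 'rV[K]_n) : is_ideal R I ->
  (forall y, y \in G ->
    [/\ inS R y, inS R (f y), inS I (y - f y) & f y \in G']) ->
  generates R I G -> generates R I G'.
Proof.
move=> idI fG gG v /gG[w Gw Iw]; have [IR I0 ID IM] := idI.
suff [w' G'w' Iw'] : exists2 w', lincomb R G' w' & inS I (w - w').
  by exists w' => // k; rewrite -(subrK w v) -addrA mxE ID.
elim: Gw => [|a l u Ra Gl _ [u' G'u' Iu']].
  by exists 0 => [|k]; [apply: lincomb0 | rewrite subrr mxE].
exists (a *: mono (map f l) + u').
  by apply: lincombD => // _ /mapP[y /Gl/fG[_ _ _ G'y] ->].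
have [y /Gl/fG[Ry Rfy Iy _]//|_ _ Il] := @mono_congr I id f l idI.
move=> k; rewrite opprD addrACA -scalerBr mxE ID // mxE IM //.
by rewrite map_id in Il.
Qed.

Lemma det_congr I (A B : 'M[K]_n) : is_ideal R I ->
  (forall i j, [/\ A i j \in R, B i j \in R & A i j - B i j \in I]) ->
  \det A - \det B \in I.
Proof.
move=> idI AB; have [IR I0 ID IM] := idI.
rewrite -sumrB; apply: (ideal_sum _ idI) => s _.
rewrite -mulrBr IM ?rpred_sign //.
suff [] : [/\ \prod_i A i (s i) \in R, \prod_i B i (s i) \in R &
    \prod_i A i (s i) - \prod_i B i (s i) \in I] by [].
elim/big_rec2: _ => [|i y x _ [Rx Ry Ixy]]; first by rewrite !rpred1 subrr.
have [RA RB IAB] := AB i (s i); rewrite !rpredM //; split=> //.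
rewrite -[A _ _ * _](subrK (A i (s i) * y)) -mulrBr -addrA -mulrBl.
by rewrite [_ * y]mulrC ID ?IM.
Qed.

(* A congruence e_i = w_i mod p between the standard basis and elements w_i of
   the subalgebra gives a determinant d = 1 mod p with d e_i in the subalgebra,
   so the conductor of the subalgebra lies in no maximal ideal. *)
Lemma generates_local G : (forall x, x \in G -> inS R x) ->
  (forall p, is_maximal_ideal R p -> generates R p G) ->
  generates R zero_pred G.
Proof.
move=> RG gG.
(* [I] is the conductor: the scalars in [R] that carry all of [R^n] into the span of monomials. *)
pose I : {pred K} := [pred a |
  `[< a \in R /\ forall i, lincomb R G (a *: delta_mx 0 i) >]].
have idI : is_ideal R I.
  split.
  - by move=> x /asboolP[].
  - apply/asboolP; split=> [|i]; first exact: rpred0.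
    by rewrite scale0r; apply: lincomb0.
  - move=> x y /asboolP[Rx Ix] /asboolP[Ry Iy]; apply/asboolP.
    by split=> [|i]; [rewrite rpredD | rewrite scalerDl; apply: lincomb_add].
  - move=> a x Ra /asboolP[Rx Ix]; apply/asboolP.
    split=> [|i]; first by rewrite rpredM.
    by rewrite -scalerA; apply: lincombZ => // b Rb; rewrite rpredM.
have [/asboolP[_ I1]|I1] := boolP (1 \in I).
  apply: (generates_basis (zero_ideal R)) => i; exists (delta_mx 0 i).
    by rewrite -[delta_mx _ _]scale1r.
  by move=> k; rewrite subrr mxE inE.
have [p [maxp Ip]] := exists_maximal_ideal idI I1.
have [idp p1 _] := maxp; have [pR p0 pD pM] := idp.
have /choice[w wP] (i : 'I_n) :
    exists w, lincomb R G w /\ inS p (delta_mx 0 i - w).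
  have [|w] := gG p maxp (delta_mx 0 i); last by exists w.
  by move=> k; rewrite mxE rpred_nat.
pose W := \matrix_i w i.
have pW i k : (i == k)%:R - W i k \in p.
  by have [_ /(_ k)] := wP i; rewrite !mxE eqxx eq_sym.
have RW i k : W i k \in R.
  by rewrite -[W i k](subKr (i == k)%:R) rpredB ?rpred_nat ?pR.
have Rdet (m : nat) (A : 'M[K]_m) : (forall i j, A i j \in R) -> \det A \in R.
  move=> RA; apply: rpred_sum => s _; rewrite rpredM ?rpred_sign //.
  by apply: rpred_prod.
have: \det W \in I.
  apply/asboolP; split=> [|i]; first exact: Rdet.
  (* Row [i] of the identity [\adj W *m W = (\det W)%:M]; the cofactors lie in [R]. *)
  have -> : \det W *: delta_mx 0 i = \sum_j (\adj W) i j *: w j.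
    have -> : \sum_j (\adj W) i j *: w j = row i (\adj W *m W).
      rewrite row_mul mulmx_sum_row; apply: eq_bigr => j _.
      by rewrite rowK [row _ _ _ _]mxE.
    by rewrite mul_adj_mx; apply/rowP => k; rewrite !mxE eqxx eq_sym mulr_natr.
  apply: lincomb_sum => j _; apply: lincombZ; last by have [] := wP j.
  move=> b Rb; rewrite rpredM // mxE rpredM ?rpred_sign // Rdet // => k l.
  by rewrite 2!mxE RW.
move=> /Ip pdet; case/negP: p1.
rewrite -(det1 K n) -(subrK (\det W) (\det 1%:M)) pD //.
by apply: (det_congr idp) => i k; rewrite mxE rpred_nat.
Qed.

End Congruence.

(** * Denominators and finiteness for orders in number fields *)

Section Orders.
Set Implicit Arguments.
Unset Strict Implicit.
Variables (K : fieldExtType rat) (R : subringClosed K).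
Hypothesis orderR : is_order R.
Implicit Types (p q I : {pred K}).

Lemma rat_common_denominator (d : nat) (q : 'I_d -> rat) :
  exists2 D : nat, (0 < D)%N &
    exists z : 'I_d -> int, forall i, D%:R * q i = (z i)%:~R.
Proof.
exists (\prod_i `|denq (q i)|)%N.
  by apply: prodn_gt0 => i; rewrite absz_gt0 denq_neq0.
suff /choice[z zE] i : exists z : int,
    (\prod_i `|denq (q i)|)%N%:R * q i = z%:~R by exists z.
exists (numq (q i) * (\prod_(j | j != i) `|denq (q j)|)%N%:Z).
have denqE x : `|denq x|%N%:R = (denq x)%:~R :> rat.
  by rewrite -[in RHS]absz_denq.
by rewrite (bigD1 i) //= natrM denqE mulrAC [_ * q i]mulrC -numqE intrM.
Qed.

Lemma natr_injective : injective (fun i : nat => i%:R : K).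
Proof.
move=> i j; rewrite -!(rmorph_nat (in_alg K)) => /fmorph_inj/eqP.
by rewrite eqr_nat => /eqP.
Qed.

Lemma natr_neq0 D : (0 < D)%N -> D%:R != 0 :> K.
Proof. by rewrite lt0n; apply: contra => /eqP/(@natr_injective D 0) ->. Qed.

(** Clearing denominators shows that a [Z]-basis of [R] is free over [rat], hence a basis of [K] by
    dimension. A common denominator of the coordinates of [a] then works. *)
Lemma order_denominator (a : K) : exists2 D : nat, (0 < D)%N & D%:R * a \in R.
Proof.
have [_ _ _ [b [bfree bspan]]] := orderR.
pose X := [tuple b i | i < \dim {:K}].
have intZ (z : int) (x : K) : z%:~R * x = (z%:~R : rat) *: x.
  by rewrite scaler_int mulrzl.
have clear (q : 'I_(\dim {:K}) -> rat) : exists2 D : nat, (0 < D)%N &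
    exists z : 'I_(\dim {:K}) -> int, (forall i, D%:R * q i = (z i)%:~R) /\
      D%:R * (\sum_i q i *: b i) = \sum_i (z i)%:~R * b i.
  have [D D0 [z zE]] := rat_common_denominator q; exists D => //; exists z.
  split=> //; rewrite mulr_sumr; apply: eq_bigr => i _.
  by rewrite intZ -zE -scalerA scaler_nat mulr_natl.
have Xfree : free X.
  apply/freeP => q q0 i; have [D D0 [z [zE zb]]] := clear q.
  have /bfree/(_ i) zi : \sum_i (z i)%:~R * b i = 0.
    rewrite -zb; under eq_bigr do rewrite -(tnth_mktuple b) (tnth_nth 0).
    by rewrite q0 mulr0.
  have /eqP := zE i; rewrite zi mulf_eq0 => /orP[|/eqP//].
  by rewrite pnatr_eq0 -leqn0 leqNgt D0.
have Xa : a \in <<X>>%VS.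
  suff -> : <<X>>%VS = fullv by rewrite memvf.
  apply/eqP; rewrite eqEdim subvf /=.
  by rewrite (eqP Xfree) size_tuple.
have [D D0 [z [_ zb]]] := clear (fun i => coord X i a).
exists D => //; rewrite (coord_span Xa).
under eq_bigr do rewrite -tnth_nth tnth_mktuple.
by rewrite zb; apply/bspan; exists z.
Qed.

(* A maximal ideal containing D is determined by the classes mod D of the
   coordinates of its elements. *)
Lemma finite_maximal_over D : (0 < D)%N ->
  exists (T : finType) (code : {pred K} -> T),
  forall p q, is_maximal_ideal R p /\ D%:R \in p ->
    is_maximal_ideal R q /\ D%:R \in q -> code p = code q -> p = q.
Proof.
case: D => // D _; have [_ _ _ [b [_ bspan]]] := orderR.
pose val_of (f : {ffun 'I_(\dim {:K}) -> 'I_D.+1}) :=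
  \sum_i (f i : nat)%:R * b i.
exists {set {ffun 'I_(\dim {:K}) -> 'I_D.+1}},
  (fun p => [set f | val_of f \in p]%SET).
have bR i : b i \in R.
  apply/bspan; exists (fun j => (j == i)%:Z); rewrite (bigD1 i) //= eqxx mul1r.
  by rewrite big1 ?addr0 // => j /negPf->; rewrite mul0r.
suff sub p q : is_maximal_ideal R p /\ D.+1%:R \in p ->
    is_maximal_ideal R q /\ D.+1%:R \in q ->
    [set f | val_of f \in p]%SET = [set f | val_of f \in q]%SET ->
    {subset p <= q}.
  move=> p q hp hq pq; apply: functional_extensionality_dep => x.
  by apply/idP/idP; [apply: (sub p q) | apply: (sub q p)].
move=> [[idp _ _] Dp] [[idq _ _] Dq] pq x px.
have [pR p0 pD pM] := idp; have [qR q0 qD qM] := idq.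
have /bspan[z xz] := pR x px.
(* Reducing the coordinates of [x] changes it by a multiple of [D.+1], which lies in both [p] and
   [q]. *)
pose f := [ffun i => inord `|(z i %% D.+1)%Z|] :
  {ffun 'I_(\dim {:K}) -> 'I_D.+1}.
have [y Ry xf] : exists2 y, y \in R & x - val_of f = y * D.+1%:R.
  exists (\sum_i (z i %/ D.+1)%Z%:~R * b i).
    by apply: rpred_sum => i _; rewrite rpredM ?rpred_int ?bR.
  rewrite xz -sumrB mulr_suml; apply: eq_bigr => i _.
  rewrite ffunE inordK; last first.
    by rewrite -ltz_nat gez0_abs ?modz_ge0 // ltz_pmod.
  rewrite -mulrBl -mulrA [b i * _]mulrC mulrA; congr (_ * _).
  have -> : (`|(z i %% D.+1)%Z|%N%:R : K) = (z i %% D.+1)%Z%:~R.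
    by rewrite -[in RHS](gez0_abs (modz_ge0 _ _)).
  rewrite {1}(divz_eq (z i) D.+1) intrD addrK intrM.
  by [].
have fp : val_of f \in p.
  by rewrite -(subKr x (val_of f)) xf (ideal_sub idp) // pM.
have: f \in [set f | val_of f \in q]%SET by rewrite -pq inE.
by rewrite inE => fq; rewrite -(subrK (val_of f) x) xf qD // qM.
Qed.

(** The inverses of the multiples of [D] are infinitely many distinct elements, whereas [P] has
    finitely many roots. Taking inverses makes the coefficient [s^-1] of the deformation a multiple
    of [D]. *)
Lemma nonroot_inverse_natr (P : {poly K}) D : P != 0 -> (0 < D)%N ->
  exists2 k : nat, (0 < k)%N & P.[(D * k)%:R^-1] != 0.
Proof.
move=> P0 D0.
have [//|no] := pselect (exists2 k : nat, (0 < k)%N & P.[(D * k)%:R^-1] != 0).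
pose rs := [seq (D * k.+1)%:R^-1 : K | k <- iota 0 (size P)].
suff : (size rs < size P)%N by rewrite size_map size_iota ltnn.
apply: max_poly_roots => //.
  apply/allP => x /mapP[k _ ->]; rewrite rootE; apply/negPn/negP => Pk.
  by case: no; exists k.+1.
rewrite map_inj_uniq ?iota_uniq // => i j /invr_inj/natr_injective/eqP.
by rewrite eqn_pmul2l // => /eqP[].
Qed.

End Orders.

(** * From generators over [K] and modulo maximal ideals to generators over [R] *)

Section Lifting.
Set Implicit Arguments.
Unset Strict Implicit.
Variables (K : fieldExtType rat) (R : subringClosed K) (n : nat).
Variables (c : 'I_n -> 'I_n -> 'I_n -> K) (one : 'rV[K]_n).
Hypotheses (orderR : is_order R).
Hypotheses (Rc : forall i j k, c i j k \in R) (Rone : inS R one).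
Implicit Types (p I : {pred K}) (G x y z : seq 'rV[K]_n).

Local Notation lincomb := (lincomb c one).
Local Notation generates := (generates c one).
Local Notation integral G := (forall v, v \in G -> inS R v).

Lemma lincomb_denominator G w : lincomb all_pred G w ->
  exists2 D : nat, (0 < D)%N & lincomb R G (D%:R *: w).
Proof.
have natZ (D : nat) v : lincomb R G v -> lincomb R G (D%:R *: v).
  by apply: lincombZ => b Rb; rewrite rpredM ?rpred_nat.
elim=> [|a l v _ Gl _ [D D0 GD]].
  by exists 1%N => //; rewrite scaler0; apply: lincomb0.
have [E E0 RE] := order_denominator orderR a.
exists (D * E)%N; first by rewrite muln_gt0 D0.
rewrite scalerDr scalerA natrM; apply: lincombD => //.
  by rewrite -mulrA rpredM ?rpred_nat.
by rewrite mulrC -scalerA; apply: natZ.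
Qed.

(** [D] clears the denominators in expressions of the standard basis vectors; when it is invertible
    modulo [p], these expressions survive reduction. *)
Lemma generic_good_reduction G : generates all_pred zero_pred G ->
  exists2 D : nat, (0 < D)%N &
    forall p, is_maximal_ideal R p -> D%:R \notin p -> generates R p G.
Proof.
move=> gG.
have /choice[D DP] (i : 'I_n) :
    exists D : nat, (0 < D)%N /\ lincomb R G (D%:R *: delta_mx 0 i).
  have [//|w Gw w0] := gG (delta_mx 0 i).
  have -> : delta_mx 0 i = w.
    by apply/rowP => k; have := w0 k; rewrite !mxE => /eqP/subr0_eq.
  by have [D] := lincomb_denominator Gw; exists D.
exists (\prod_i D i)%N; first by apply: prodn_gt0 => i; have [] := DP i.
move=> p maxp Dp; have [idp _ _] := maxp; have [_ p0 _ pM] := idp.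
have [u Ru pu] := maximal_inverse maxp (rpred_nat _ _) Dp.
apply: (generates_basis idp) => i.
exists ((u * (\prod_i D i)%:R) *: delta_mx 0 i).
  rewrite (bigD1 i) //= natrM mulrCA mulrC -scalerA mulrC.
  apply: lincombZ; last by have [] := DP i.
  by move=> b Rb; rewrite !rpredM ?rpred_nat.
move=> k; rewrite -{1}[delta_mx _ _]scale1r -scalerBl !mxE eqxx mulrC.
by rewrite pM ?rpred_nat.
Qed.

(** All generators are multiplied by one common denominator of their coordinates. *)
Lemma generates_integral G : generates all_pred zero_pred G ->
  exists G',
    [/\ size G' = size G, integral G' & generates all_pred zero_pred G'].
Proof.
move=> gG.
have den (s : seq K) :
    exists2 D : nat, (0 < D)%N & {in s, forall a, D%:R * a \in R}.
  elim: s => [|a s [D D0 sD]]; first by exists 1%N.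
  have [E E0 aE] := order_denominator orderR a.
  exists (D * E)%N => [|x]; first by rewrite muln_gt0 D0.
  rewrite inE natrM => /orP[/eqP->|/sD Rx].
    by rewrite -mulrA rpredM ?rpred_nat.
  by rewrite mulrAC mulrC rpredM ?rpred_nat.
have [D D0 GD] := den [seq v 0 k | v : 'rV[K]_n <- G, k : 'I_n <- enum 'I_n].
exists [seq D%:R *: v | v <- G]; split; first by rewrite size_map.
  move=> _ /mapP[v Gv ->] k; rewrite mxE GD //.
  by apply/allpairsP; exists (v, k); rewrite mem_enum.
move=> v _; exists v; last by move=> k; rewrite subrr mxE inE.
have [//|w Gw w0] := gG v.
have -> : v = w by apply/rowP => k; have := w0 k; rewrite !mxE => /eqP/subr0_eq.
apply: (lincomb_rescale (f := fun v => D%:R *: v) (a := fun=> D%:R^-1) _ Gw).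
move=> u Gu.
split; first exact: map_f.
by rewrite scalerA mulVf ?scale1r ?natr_neq0.
Qed.

(* [x] is the part of the tuple already chosen, [m] the number of free slots, and
   [z] completes [x] generically. *)
Lemma extend_generators m x z : integral x -> integral z ->
  z = [::] \/ (size z < m)%N ->
  generates all_pred zero_pred (x ++ z) ->
  (forall p, is_maximal_ideal R p -> exists y,
      [/\ (size y <= m)%N, integral y & generates R p (x ++ y)]) ->
  exists y, [/\ (size y <= m)%N, integral y & generates R zero_pred (x ++ y)].
Proof.
elim: m x z => [|m IH] x z Rx Rz sz gz gx.
  (* With no free slot, every local completion is empty, so [x] itself generates modulo each maximal
     ideal. *)
  exists [::]; split=> //; rewrite cats0; apply: generates_local => // p.
  by move=> /gx[[|a y] [] // _ _]; rewrite cats0.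
have [D D0 goodD] := generic_good_reduction gz.
have [T [code codeI]] := finite_maximal_over orderR D0.
(* The target is the first entry of a completion at an exceptional [p], and 0 if that completion is
   empty or [p] does not contain [D]. *)
have /choice[target tP] p : exists t, inS R t /\
    (is_maximal_ideal R p /\ D%:R \in p -> exists y,
      [/\ (size y <= m)%N, integral y & generates R p (x ++ t :: y)]).
  have [[maxp Dp]|Np] := pselect (is_maximal_ideal R p /\ D%:R \in p); last first.
    by exists 0; split=> // k; rewrite mxE rpred0.
  have [[|t y] [ym Ry gy]] := gx p maxp.
    exists 0; split=> [k|_]; first by rewrite mxE rpred0.
    exists [::]; split=> //; apply: generates_subset gy => v.
    by rewrite cats0 mem_cat => ->.
  exists t; split=> [|_]; first by apply: Ry; rewrite mem_head.
  by exists y; split=> // v yv; apply: Ry; rewrite inE yv orbT.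
have [|t0 Rt0 t0P] := maximal_crt _ codeI (fun p => proj1 (tP p)).
  by move=> p [].
(* If [z] is empty, [x] already generates over [K] and [t0] will do. Otherwise a suitable multiple
   of the head of [z] is added, with coefficient divisible by [D] so that nothing changes at the
   exceptional ideals. *)
have [t [Rt tE gt]] : exists t, [/\ inS R t,
    forall p, is_maximal_ideal R p /\ D%:R \in p -> inS p (t - target p) &
    generates all_pred zero_pred ((x ++ [:: t]) ++ behead z)].
  case: z Rz gz {sz goodD} => [|z0 z] Rz gz.
    exists t0; split=> //; apply: generates_subset gz => v.
    by rewrite !cats0 mem_cat => ->.
  have [P P0 gP] := generates_deform t0 gz.
  have [k k0 Pk] := nonroot_inverse_natr P0 D0.
  have Dk0 : (D * k)%:R != 0 :> K by rewrite natr_neq0 // muln_gt0 D0.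
  exists (t0 + (D * k)%:R *: z0); split.
  - move=> i; rewrite !mxE rpredD //; first exact: Rt0.
    by rewrite rpredM ?rpred_nat //; apply: Rz; rewrite mem_head.
  - move=> p hp i; have [[[pR p0 pD pM] _ _] Dp] := hp.
    rewrite addrAC mxE pD //; first exact: t0P.
    rewrite mxE mulrC mulnC natrM mulrA pM // rpredM ?rpred_nat //.
    by apply: Rz; rewrite mem_head.
  - by rewrite -catA /= -[(D * k)%:R]invrK; apply: gP; rewrite ?invr_eq0.
have [||||y [ym Ry gy]] := IH (x ++ [:: t]) (behead z) _ _ _ gt.
- by move=> v; rewrite mem_cat inE => /orP[/Rx//|/eqP->].
- by move=> v /mem_behead/Rz.
(* Both [m] and the length of a nonempty [z] drop by one, so the strict bound persists until [z] is
   exhausted. *)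
- by case: sz => [->|]; [left | case: (z) => [|a [|b s]]; [left|left|right]].
(* At exceptional [p], the local completion is kept with [target p] replaced by [t]. Elsewhere [z],
   of length at most [m], completes [x] even without [t]. *)
- move=> p maxp; have [Dp|/(goodD p maxp) gp] := boolP (D%:R \in p).
    have [_ /(_ (conj maxp Dp))[y [ym Ry gy]]] := tP p.
    exists y; split=> //; have [idp _ _] := maxp; have [pR p0 pD pM] := idp.
    apply: (generates_congr Rc Rone
      (f := fun v => if v == target p then t else v) idp _ gy).
    move=> v; have [-> _|vt] := eqVneq.
      split=> //; first by have [] := tP p.
      + by rewrite -opprB => k; rewrite mxE -mulN1r pM ?rpredN1 // tE.
      + by rewrite !mem_cat inE eqxx orbT.
    rewrite !mem_cat !inE (negPf vt) /= => vG; split=> //.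
    + by case/orP: vG => [/Rx|/Ry].
    + by case/orP: vG => [/Rx|/Ry].
    + by move=> k; rewrite subrr mxE.
    + by case/orP: vG => ->; rewrite ?orbT.
  exists z; split=> //.
    by case: sz => [->|].
  apply: generates_subset gp => v; rewrite !mem_cat.
  by move=> /orP[]->; rewrite ?orbT.
exists (t :: y); split=> //; last by rewrite -catA in gy.
by move=> v; rewrite inE => /orP[/eqP->|/Ry].
Qed.

(** The extension process is started with no chosen entry and with [z] an integral generating list
    over [K]; the strict inequality supplies its spare slot. *)
Lemma generated_by_locally r0 k : generated_by all_pred zero_pred c one r0 ->
  (forall p, is_maximal_ideal R p -> generated_by R p c one k) -> (r0 < k)%N ->
  generated_by R zero_pred c one k.
Proof.
move=> /generated_byP[G0 [<- _ /generates_integral[G [<- RG gG]]]] loc lt_k.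
have [||||p maxp|y [yk Ry gy]] := @extend_generators k [::] G => //.
- by right.
- by have /generated_byP[y [<- Ry gy]] := loc p maxp; exists y.
exact: generates_generated_by gy.
Qed.

End Lifting.

(** * Comparison of the minimal numbers of generators *)

Lemma exists_least_nat {P : nat -> Prop} {m} :
  P m -> exists2 k, least_nat P k & (k <= m)%N.
Proof.
move=> Pm; have exP : exists k, `[< P k >] by exists m; apply/asboolP.
case: (ex_minnP exP) => k /asboolP Pk kmin; exists k; last by apply/kmin/asboolP.
by split=> // j Pj; apply/kmin/asboolP.
Qed.

Theorem mainTheorem4 (K : fieldExtType rat) (R : {pred K}) (n : nat)
    (c : 'I_n -> 'I_n -> 'I_n -> K) (one : 'rV[K]_n) (r r0 : nat) :
  is_order R ->
  is_free_algebra R c one ->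
  (* r = r(A, R) *)
  least_nat (generated_by R zero_pred c one) r ->
  (* r0 = r(A (x)_R K, K) *)
  least_nat (generated_by all_pred zero_pred c one) r0 ->
  (* first claim: r_p = r(A (x)_R kappa(p), kappa(p)) = r(A/pA, R/p) *)
  ((exists p : {pred K}, is_maximal_ideal R p /\
      exists s, least_nat (generated_by R p c one) s /\ (r0 < s)%N) ->
   (forall p : {pred K}, is_maximal_ideal R p ->
      forall s, least_nat (generated_by R p c one) s -> (s <= r)%N) /\
   (exists p : {pred K}, is_maximal_ideal R p /\
      least_nat (generated_by R p c one) r)) /\
  (* second claim *)
  ((forall p : {pred K}, is_maximal_ideal R p ->
      least_nat (generated_by R p c one) r0) ->
   (r0 <= r <= r0.+1)%N).
Proof.
move=> orderR [Rc Rone _ _] [gr rmin] [gr0 r0min].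
have [R' RE] : exists R' : subringClosed K, (R' : {pred K}) = R.
  have [R1 RB RM _] := orderR.
  pose R' : subringClosed K :=
    HB.pack R (GRing.isSubringClosed.Build K R (And3 R1 RB RM)).
  by exists R'.
subst R; have locally := generated_by_locally orderR Rc Rone gr0.
(* Generators over [R] reduce to generators modulo [p], so every local number is at most [r]. *)
have reduce p : is_maximal_ideal R' p -> generated_by R' p c one r.
  move=> [[_ p0 _ _] _ _]; have /generated_byP[G [Gr RG gG]] := gr.
  apply/generated_byP; exists G; split=> //.
  by apply: generates_ideal_subset gG => x /eqP->.
split=> [[p [maxp [s [[gs smin] r0s]]]]|loc].
  split=> [q maxq t [_ tmin]|]; first exact/tmin/reduce.
  have [//|no] := pselect (exists q,
    is_maximal_ideal R' q /\ least_nat (generated_by R' q c one) r).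
  have lt_r q t : is_maximal_ideal R' q ->
      least_nat (generated_by R' q c one) t -> (t < r)%N.
    move=> maxq least_t; have [_ tmin] := least_t.
    rewrite ltn_neqAle (tmin _ (reduce q maxq)) andbT; apply/eqP => tr.
    by case: no; exists q; rewrite -tr.
  have s_lt_r := lt_r p s maxp (conj gs smin).
  suff /rmin : generated_by R' zero_pred c one r.-1.
    by case: (r) s_lt_r => // r'; rewrite ltnn.
  apply: locally => [q maxq|]; last by case: (r) s_lt_r => // r' /(leq_trans r0s).
  have [t least_t _] := exists_least_nat (reduce q maxq).
  have [gt _] := least_t; apply: generated_by_leq gt.
  by have := lt_r q t maxq least_t; case: (r).
apply/andP; split.
  apply: r0min; have /generated_byP[G [<- RG gG]] := gr.
  by apply/generated_byP; exists G; split=> //; apply: generates_field gG.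
(* Lifting is applied with [k = r0.+1]: the extra generator provides the required strict
   inequality. *)
apply/rmin/locally => // p maxp; have [gp _] := loc p maxp.
exact: generated_by_leq (leqnSn _) gp.
Qed.
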